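(* There exist constants $\gamma^*,\varepsilon^*>0$ such that for all $n$ large enough and (deterministically) for every integer $k\in\{2,3,\ldots,n-2\}$, the Markov chain $X$ on the $n$-cycle with added edge $(k,n)$ described in the context satisfies $$t_{\rm mix}(X,\varepsilon^* )\ge\gamma^* n^{3/2}.$$
   Context: The Markov chain. Let $V=\{1,2,\ldots,n\}$ be the vertices of a cycle and $2\le k\le n-2$ an integer. Write $a_i=i$ for $1\le i\le k$ (arc $A$) and $b_j=k+j$ for $1\le j\le n-k$ (arc $B$). The vertices $a_k=k$ and $b_{n-k}=n$ are called hubs, and an edge between them is added. The chain $X(t)$, $t=0,1,2,\ldots$, on $V$ has transition probabilities - $P(a_i,a_{i+1})=P(b_j,b_{j+1})=1/2$ for $1\le i\le k-1$, $1\le j\le n-k-1$; - $P(a_k,b_1)=P(b_{n-k},a_1)=1/2$; - $P(a_i,a_i)=P(b_j,b_j)=1/2$ for $1\le i\le k-1$, $1\le j\le n-k-1$; - $P(a_k,a_k)=P(a_k,b_{n-k})=P(b_{n-k},a_k)=P(b_{n-k},b_{n-k})=1/4$; and all other entries are $0$. The unique stationary distribution is the uniform distribution $\pi$ on $V$. Mixing time. For probability distributions $\mu,\sigma$ on $V$, $\|\mu-\sigma\|_{\rm TV}=\frac12\sum_{x\in V}|\mu(x)-\sigma(x)|$. Let $\mathcal L(X(t))$ be the law of $X(t)$, $d_X(t)=\sup_{X(0)\in V}\|\mathcal L(X(t))-\pi\|_{\rm TV}$ (supremum over deterministic starting vertices), and $t_{\rm mix}(X,\varepsilon)=\min\{t: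 d_X(t)\le\varepsilon\}$. *)

(* Defs.v *)
From HB Require Import structures.
From mathcomp Require Import all_boot all_order all_algebra.
From mathcomp Require Import all_classical all_reals ereal exp.

Set Implicit Arguments.
Unset Strict Implicit.
Unset Printing Implicit Defensive.

Import Order.TTheory GRing.Theory Num.Theory.
Local Open Scope classical_set_scope.
Local Open Scope ring_scope.

(* Distributions on a state space 'I_n are row vectors; a transition matrix
   P : 'M_n acts on them on the right, P x y being the probability of x -> y. *)
Section MarkovChain.
Context {R : realType} {n : nat}.
Implicit Types (mu nu pi : 'rV[R]_n) (P : 'M[R]_n).

Definition tv_dist mu nu : R := 2^-1 * \sum_x `|mu 0 x - nu 0 x|.

Definition uniform_dist : 'rV[R]_n := const_mx (n%:R^-1).

Definition law P (x : 'I_n) (t : nat) : 'rV[R]_n := delta_mx 0 x *m P ^+ t.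

(* The default 0 of the maximum is harmless: total variation is >= 0. *)
Definition mix_dist P pi (t : nat) : R :=
  \big[Num.max/0]_(x < n) tv_dist (law P x t) pi.

(* The least t with mix_dist P pi t <= eps, as an extended real: it is +oo
   if there is no such t (as for a chain that does not converge to pi). *)
Definition mixing_time P pi (eps : R) : \bar R :=
  ereal_inf [set (t%:R)%:E | t in [set t : nat | mix_dist P pi t <= eps]].

End MarkovChain.

(* Entry (x, y) of the transition matrix, for vertices labelled 1, ..., n:
   a_i is the label i (i <= k), b_j is the label k + j, and the hubs are
   a_k = k and b_(n-k) = n.  The first case gathers all the moves x -> x + 1
   (including a_k -> b_1) and b_(n-k) -> a_1; for 2 <= k <= n - 2 it is
   disjoint from the second one, which gathers the four hub-to-hub entries. *)
Definition cycle_edge_entry (R : realType) (n k x y : nat) : R :=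
  if (x < n)%N && (y == x.+1) || (x == n) && (y == 1%N) then 1 / 2
  else if (x \in [:: k; n]) && (y \in [:: k; n]) then 1 / 4
  else if y == x then 1 / 2
  else 0.

(* The ordinal i : 'I_n stands for the vertex labelled i + 1. *)
Definition cycle_edge_chain (R : realType) (n k : nat) : 'M[R]_n :=
  \matrix_(i, j) cycle_edge_entry R n k i.+1 j.+1.

(* Main.v *)
Require Import Defs.
From mathcomp Require Import all_boot all_order all_algebra.
From mathcomp Require Import all_classical all_reals ereal exp.
From mathcomp Require Import all_fingroup ring lra zify.

Import Order.TTheory GRing.Theory Num.Theory.
Local Open Scope ring_scope.

(** The transition matrix is P = 1/2 C + 1/4 I + 1/4 T, where C rotates the
    cycle by one vertex and T transposes the two hubs. So the chain can be run
    as follows: at each time rotate with probability 1/2, rest with probability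
    1/4, apply T with probability 1/4. Let M be the number of rotations up to
    time t, and D the number of jumps from hub n to hub k minus the number of
    jumps from k to n. Modulo n a jump moves the chain by k or by -k, hence
    X(t) = x0 + M + k D modulo n, and X(t) takes few values as soon as M and D
    do.

    - M is exactly binomial (t, 1/2), so E (2 M - t)^2 = t
      ([iter_lifted_step_rotations]).
    - If [X in B] is 1 on the arc B and 0 on the arc A, then
      3 D + [X in B] is a martingale. Its increments vanish away from the hubs
      and have variance 3/2 at them, so its second moment is the initial one
      plus 3/2 times the expected number of visits to the hubs
      ([iter_lifted_step_jumps]). As P is doubly stochastic, this number
      averages 2 t / n over the starting vertices ([sum_hub_visits]), so some
      starting vertex has at most 2 t / n expected hub visits.

    For t of order n^(3/2), M thus lives in a window of width of order n^(3/4)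
    and D in a window of width of order n^(1/4). With small enough constants,
    Chebyshev's inequality puts mass 3/4 on a set of at most n / 4 vertices
    ([hub_walk_tube], [card_tube]), and this keeps the chain away from
    uniformity ([mix_dist_gt]).

    Expectations over the pair (M, D) are computed by iterating the backward
    operator of the lifted walk (X, M, D), so that no path space is needed. *)

(** * Vertices reached by few rotations and jumps *)

Section Tube.
Context {n : nat} (a : 'I_n).

(** The vertices x0 + m + (a+1) d modulo n for h - A < m <= h + A, where h is
    the integer part of t/2, and - B <= d < B. The ordinal [a] stands for the
    vertex labelled k, so that [a.+1] is k. *)
Definition tube (x0 : 'I_n) (t A B : nat) : {set 'I_n} :=
  [set insubd a
     `|((x0%:Z + (t./2%:Z - A%:Z + 1 + p.1%:Z)
          + a.+1%:Z * (p.2%:Z - B%:Z))%R %% n%:Z)%Z|%N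
     | p : 'I_(2 * A) * 'I_(2 * B)].

Lemma card_tube x0 t A B : (#|tube x0 t A B| <= 4 * (A * B))%N.
Proof.
apply: leq_trans (leq_imset_card _ _) _.
by rewrite card_prod !card_ord; lia.
Qed.

(** The congruence x = x0 + m + k d modulo n, with an explicit quotient so that
    linear arithmetic can follow a step of the walk. *)
Definition unwinds (x0 x : 'I_n) (m d : int) : Prop :=
  exists q : int,
    x%:Z = x0%:Z + m + a.+1%:Z * d + q * n%:Z.

Lemma unwinds_tube x0 x m d t A B : unwinds x0 x m d ->
    t%:Z - 2 * A%:Z < 2 * m < t%:Z + 2 * A%:Z ->
    - (3 * B%:Z) < 3 * d + (a < x)%N%:Z < 3 * B%:Z ->
  x \in tube x0 t A B.
Proof.
move=> [q xE] mP dP.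
have te := odd_double_half t.
have [i iE] : exists i : nat, m = t./2%:Z - A%:Z + 1 + i%:Z.
  by exists (absz (m - (t./2%:Z - A%:Z + 1))%R); lia.
have [j jE] : exists j : nat, d = j%:Z - B%:Z.
  by exists (absz (d + B%:Z)%R); lia.
have iA : (i < 2 * A)%N by lia.
have jB : (j < 2 * B)%N by lia.
apply/imsetP; exists (Ordinal iA, Ordinal jB) => //=.
rewrite -iE -jE; apply: val_inj; rewrite val_insubd.
have -> : x0%:Z + m + a.+1%:Z * d = (- q) * n%:Z + x%:Z by lia.
by rewrite modzMDl modz_small /= ?ltn_ord // ltz_nat ltn_ord.
Qed.

End Tube.

(** * The walk lifted to its numbers of rotations and jumps *)

Section LiftedWalk.
Context {R : realType} {n : nat} (a b : 'I_n).

(** The signed multiple of k, modulo n, by which the transposition of the hubs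
    [a] (label k) and [b] (label n) moves the vertex [x]. *)
Definition jump_sign (x : 'I_n) : int := (x == b)%:Z - (x == a)%:Z.

(** The backward (Koopman) operator: [iter t lifted_step f x m d] is the
    expectation of [f] after t steps of the lifted walk started at
    [(x, m, d)]. *)
Definition lifted_step (f : 'I_n -> int -> int -> R) (x : 'I_n) (m d : int) : R :=
  2^-1 * f (ordS x) (m + 1) d + 4^-1 * f x m d
    + 4^-1 * f (tperm a b x) m (d + jump_sign x).

Definition hub_walk : 'M[R]_n :=
  \matrix_(x, y) (2^-1 * (y == ordS x)%:R + 4^-1 * (y == x)%:R
                    + 4^-1 * (y == tperm a b x)%:R).

Lemma hub_walk_mul (h : 'cV[R]_n) (x : 'I_n) :
  (hub_walk *m h) x 0 =
  2^-1 * h (ordS x) 0 + 4^-1 * h x 0 + 4^-1 * h (tperm a b x) 0.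
Proof.
have pick z : \sum_y (y == z)%:R * h y 0 = h z 0.
  by rewrite (bigD1 z) //= eqxx mul1r big1 ?addr0 // => y /negPf->; rewrite mul0r.
rewrite mxE -!pick !mulr_sumr -!big_split /=.
by apply: eq_bigr => y _; rewrite mxE !mulrDl -!mulrA.
Qed.

Lemma iter_lifted_step_vertex (h : 'cV[R]_n) t x m d :
  iter t lifted_step (fun y _ _ => h y 0) x m d = (hub_walk ^+ t *m h) x 0.
Proof.
elim: t x m d => [|t IH] x m d; first by rewrite expr0 mul1mx.
by rewrite iterS exprS -mulmxE -mulmxA hub_walk_mul /lifted_step !IH.
Qed.

(** The congruence between the vertex and the two counters holds only along
    trajectories, so functions have to be compared on an invariant of the walk
    rather than everywhere. *)
Lemma iter_lifted_step_le (I : 'I_n -> int -> int -> Prop)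
    (f g : 'I_n -> int -> int -> R) :
    (forall x m d, I x m d ->
      I (ordS x) (m + 1) d /\ I (tperm a b x) m (d + jump_sign x)) ->
    (forall x m d, I x m d -> f x m d <= g x m d) ->
  forall t x m d, I x m d ->
    iter t lifted_step f x m d <= iter t lifted_step g x m d.
Proof.
move=> closedI le_fg; elim=> [|t IH] x m d Ix; first exact: le_fg.
have [ImS IdS] := closedI _ _ _ Ix.
by rewrite !iterS /lifted_step; have := IH _ _ _ Ix; have := IH _ _ _ ImS;
  have := IH _ _ _ IdS; lra.
Qed.

(** A rotation has probability 1/2 at every vertex, hub or not, so the number of
    rotations does not feel the position: 2 m - c has drift 1 and variance 1 per
    step. *)
Lemma iter_lifted_step_rotations (c : R) t x m d :
  iter t lifted_step (fun _ m _ => (2 * m%:~R - c) ^+ 2) x m d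
    = (2 * m%:~R + t%:R - c) ^+ 2 + t%:R.
Proof.
elim: t x m d => [|t IH] x m d; first by rewrite /= !addr0.
by rewrite iterS /lifted_step !IH -(natr1 t) rmorphD /=; field.
Qed.

Lemma iter_lifted_step_lin (u v : R) (f g : 'I_n -> int -> int -> R) t x m d :
  iter t lifted_step (fun x m d => 1 - u * f x m d - v * g x m d) x m d
    = 1 - u * iter t lifted_step f x m d - v * iter t lifted_step g x m d.
Proof.
elim: t x m d => [|t IH] x m d //.
by rewrite !iterS /lifted_step !IH; field.
Qed.

(** Rotation, rest and transposition are bijections of the vertices, so each
    preserves the counting measure. *)
Lemma hub_walk_doubly_stochastic t :
  const_mx 1 *m hub_walk ^+ t = const_mx 1 :> 'rV[R]_n.
Proof.
elim: t => [|t IH]; first by rewrite expr0 mulmx1.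
rewrite exprS -mulmxE mulmxA -[RHS]IH; congr (_ *m _).
apply/rowP => y; rewrite !mxE.
have hit (s : 'I_n -> 'I_n) : bijective s -> \sum_x (y == s x)%:R = 1 :> R.
  case=> s' sK s'K; rewrite (bigD1 (s' y)) //= s'K eqxx big1 ?addr0 // => x ne.
  by case: eqP => // yx; rewrite yx sK eqxx in ne.
under eq_bigr do rewrite !mxE mul1r.
rewrite !big_split /= -!mulr_sumr !hit; first lra.
- exact: (Bijective (tpermK a b) (tpermK a b)).
- by exists id.
- exact: (Bijective (@ordSK n) (@ord_predK n)).
Qed.

(** The entry at [x] is the expected number of visits to the hubs at times
    s < t, for the walk started at [x]. *)
Definition hub_visits t : 'cV[R]_n :=
  \sum_(s < t) hub_walk ^+ s *m (\col_x ((x == a) || (x == b))%:R).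

Lemma hub_visitsS t :
  hub_visits t.+1 = \col_x ((x == a) || (x == b))%:R + hub_walk *m hub_visits t.
Proof.
rewrite /hub_visits big_ord_recl expr0 mul1mx mulmx_sumr; congr (_ + _).
by apply: eq_bigr => s _; rewrite exprS -mulmxE mulmxA.
Qed.

(** Started from the counting measure, which is preserved, the walk has mass 2 on
    the hubs at every time. *)
Lemma sum_hub_visits t : a != b -> \sum_x hub_visits t x 0 = (2 * t)%:R.
Proof.
move=> neq_ab.
have <- : ((const_mx 1 : 'rV[R]_n) *m hub_visits t) 0 0 = \sum_x hub_visits t x 0.
  by rewrite mxE; apply: eq_bigr => x _; rewrite mxE mul1r.
rewrite /hub_visits mulmx_sumr.
under eq_bigr do rewrite mulmxA hub_walk_doubly_stochastic.
rewrite sumr_const card_ord mulmxnE natrM mulr_natr; congr (_ *+ _).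
rewrite mxE.
under eq_bigr do rewrite !mxE mul1r.
rewrite (bigD1 a) //= (bigD1 b) ?eqxx ?orbT /=; last by rewrite eq_sym.
by rewrite big1 ?addr0 // => x /andP[/negPf-> /negPf->].
Qed.

Context (lt_ab : (a < b)%N) (b_last : b = n.-1 :> nat).

(** The summand [(a < x)] marks the arc B; it compensates the drift of the jump
    count. At the hub [a], the quantity u = 3 d + [x in B] becomes u + 1 with
    probability 1/2 (rotation into B), u with probability 1/4, and
    u - 3 + 1 with probability 1/4 (jump to [b]): mean increment 0, variance
    3/2. The hub [b] is symmetric, and nothing changes elsewhere. *)
Lemma iter_lifted_step_jumps t x m d :
  iter t lifted_step (fun x _ d => (3 * d%:~R + (a < x)%N%:R) ^+ 2) x m d
    = (3 * d%:~R + (a < x)%N%:R) ^+ 2 + 3 / 2 * hub_visits t x 0.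
Proof.
elim: t x m d => [|t IH] x m d.
  by rewrite /= /hub_visits big_ord0 mxE mulr0 addr0.
rewrite iterS /lifted_step !IH hub_visitsS mxE hub_walk_mul mxE.
rewrite /jump_sign.
have neq_ab : a != b by rewrite neq_ltn lt_ab.
have n_gt0 : (0 < n)%N by case: (n) a => [[]|].
case: (eqVneq x a) => [->|xNa].
  have -> : (a < ordS a)%N.
    by rewrite /= modn_small // (leq_ltn_trans lt_ab).
  by rewrite tpermL (negPf neq_ab) lt_ab ltnn rmorphD rmorphB /=; field.
case: (eqVneq x b) => [->|xNb].
  have -> : (a < ordS b)%N = false by rewrite /= b_last prednK // modnn.
  by rewrite tpermR lt_ab ltnn rmorphD rmorphB /=; field.
have -> : (a < ordS x)%N = (a < x)%N.
  have ltx : (x.+1 < n)%N.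
    have := ltn_ord x; have : x != b :> nat by [].
    by rewrite b_last; lia.
  rewrite /= modn_small // ltnS leq_eqVlt; have : a != x :> nat by rewrite eq_sym.
  by move/negPf->.
by rewrite tpermD 1?eq_sym // rmorphD rmorphB /=; field.
Qed.

Lemma unwinds_step x0 x m d : unwinds a x0 x m d ->
  unwinds a x0 (ordS x) (m + 1) d
  /\ unwinds a x0 (tperm a b x) m (d + jump_sign x).
Proof.
move=> [q xE]; split.
  have ltx := ltn_ord x; rewrite /unwinds /=.
  case: (ltnP x.+1 n) => [lt|ge]; first by exists q; rewrite modn_small //; lia.
  exists (q - 1); have -> : x.+1 = n by lia.
  by rewrite modnn; lia.
have neq_ab : a != b by rewrite neq_ltn lt_ab.
have ltb := ltn_ord b; rewrite /jump_sign /unwinds.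
case: (eqVneq x a) xE => [->|xNa] xE.
  by rewrite tpermL (negPf neq_ab); exists (q + 1) => /=; lia.
case: (eqVneq x b) xE => [->|xNb] xE.
  by rewrite tpermR; exists (q - 1) => /=; lia.
by rewrite tpermD 1?eq_sym //; exists q => /=; lia.
Qed.

(** Chebyshev's inequality for both counters at once: a trajectory that
    ends outside the tube has |2 m - t| >= 2 A or |3 d + [x in B]| >= 3 B. *)
Lemma hub_walk_tube x0 t A B : (0 < A)%N -> (0 < B)%N ->
  1 - t%:R / (4 * A%:R ^+ 2)
    - (1 + 3 / 2 * hub_visits t x0 0) / (9 * B%:R ^+ 2)
  <= \sum_(y in tube a x0 t A B) (hub_walk ^+ t) x0 y.
Proof.
move=> A_gt0 B_gt0; have AR : 0 < A%:R :> R by rewrite ltr0n.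
have BR : 0 < B%:R :> R by rewrite ltr0n.
pose u : R := (4 * A%:R ^+ 2)^-1; pose v : R := (9 * B%:R ^+ 2)^-1.
have u_gt0 : 0 < u by rewrite invr_gt0 mulr_gt0 // exprn_gt0.
have v_gt0 : 0 < v by rewrite invr_gt0 mulr_gt0 // exprn_gt0.
pose F (x : 'I_n) (m d : int) : R := (2 * m%:~R - t%:R) ^+ 2.
pose G (x : 'I_n) (m d : int) : R := (3 * d%:~R + (a < x)%N%:R) ^+ 2.
pose h : 'cV[R]_n := \col_y (y \in tube a x0 t A B)%:R.
have -> : \sum_(y in tube a x0 t A B) (hub_walk ^+ t) x0 y
    = iter t lifted_step (fun y _ _ => h y 0) x0 0 0.
  rewrite iter_lifted_step_vertex mxE big_mkcond /=.
  by apply: eq_bigr => y _; rewrite mxE; case: ifP; rewrite ?mulr1 ?mulr0.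
have le_h x m d : unwinds a x0 x m d ->
    1 - u * F x m d - v * G x m d <= h x 0.
  move=> Ix; rewrite mxE.
  have F_ge0 : 0 <= u * F x m d by rewrite mulr_ge0 ?sqr_ge0 // ltW.
  have G_ge0 : 0 <= v * G x m d by rewrite mulr_ge0 ?sqr_ge0 // ltW.
  case: (boolP (x \in _)) => [_|xNtube] /=; first lra.
  suff : 1 <= u * F x m d \/ 1 <= v * G x m d by case; lra.
  apply/orP; apply: contraNT xNtube; rewrite negb_or -!ltNge => /andP[ltF ltG].
  have sqr_lt (c z : int) (w : R) : 0 < c%:~R :> R -> w = (c%:~R ^+ 2)^-1 ->
      w * z%:~R ^+ 2 < 1 -> - c < z < c.
    move=> c_gt0 ->; rewrite ltr_pdivrMl ?exprn_gt0 // mulr1 => lt_zc.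
    have : `|z%:~R : R| < c%:~R.
      by rewrite -(ltr_pXn2r (n := 2)) // ?nnegrE ?ltW // real_normK ?num_real.
    by rewrite ltr_norml -rmorphN /= !ltr_int.
  have /andP[m1 m2] : - (2 * A%:Z) < 2 * m - t%:Z < 2 * A%:Z.
    apply: (sqr_lt _ _ u).
    - by rewrite rmorphM /= mulr_gt0.
    - by rewrite /u rmorphM /= exprMn; congr (_ * _)^-1; ring.
    - by rewrite rmorphB rmorphM /=.
  have /andP[d1 d2] : - (3 * B%:Z) < 3 * d + (a < x)%N%:Z < 3 * B%:Z.
    apply: (sqr_lt _ _ v).
    - by rewrite rmorphM /= mulr_gt0.
    - by rewrite /v rmorphM /= exprMn; congr (_ * _)^-1; ring.
    - by rewrite rmorphD rmorphM /=.
  by apply: (unwinds_tube _ _ _ _ _ _ _ _ Ix); lia.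
have I0 : unwinds a x0 x0 0 0 by exists 0; lia.
apply: le_trans (iter_lifted_step_le _ _ _ (unwinds_step x0) le_h t _ _ _ I0).
rewrite iter_lifted_step_lin iter_lifted_step_rotations iter_lifted_step_jumps.
rewrite !mulr0 !add0r subrr expr0n add0r.
(* The initial value of the martingale is 0 or 1. *)
have init_le1 : 0 <= 1 - ((a < x0)%N%:R : R) ^+ 2.
  by case: (a < x0)%N; rewrite ?expr1n ?expr0n ?subrr ?subr0.
have := mulr_ge0 (ltW v_gt0) init_le1; rewrite -/u -/v; lra.
Qed.

End LiftedWalk.

(** * From the chain to its mixing time *)

(** The transposition fixes every vertex that is not a hub, so there its weight
    1/4 adds up with the weight 1/4 of the identity to the holding probability
    1/2; at a hub the two weights are the four hub-to-hub entries. *)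
Lemma cycle_edge_chainE (R : realType) n k (a b : 'I_n) :
    (2 <= k <= n - 2)%N -> a.+1 = k -> b.+1 = n ->
  cycle_edge_chain R n k = hub_walk a b.
Proof.
move=> kn ak bn; apply/matrixP => i j; rewrite !mxE /cycle_edge_entry.
have lti := ltn_ord i; have ltj := ltn_ord j.
rewrite -val_eqE /= -[j == i]val_eqE /= -[j == tperm a b i]val_eqE /= !inE.
case: (eqVneq i a) => [->|iNa].
  rewrite tpermL modn_small; last lia.
  have -> : (a.+1 == n) = false by lia.
  have -> : (a.+1 < n)%N by lia.
  rewrite ak eqxx /= !orbF eqSS.
  case: (eqVneq (j : nat) k) => [->|jk].
    have -> : (k == a :> nat) = false by lia.
    have -> : (k == b :> nat) = false by lia.
    by rewrite /=; field.
  case: (eqVneq (j : nat) a) => [->|ja].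
    have -> : (a == b :> nat) = false by lia.
    by rewrite ak eqxx /=; field.
  case: (eqVneq (j : nat) b) => [->|jb].
    by rewrite bn eqxx orbT /=; field.
  have -> : (j.+1 == k) = false by lia.
  have -> : (j.+1 == n) = false by lia.
  by rewrite /=; field.
case: (eqVneq i b) => [->|iNb].
  rewrite tpermR bn ltnn eqxx modnn /= eqSS.
  have -> : (n == k) = false by lia.
  case: (eqVneq (j : nat) 0%N) => [->|j0].
    have -> : (0 == b :> nat)%N = false by lia.
    have -> : (0 == a :> nat)%N = false by lia.
    by rewrite /=; field.
  case: (eqVneq (j : nat) a) => [->|ja].
    have -> : (a == b :> nat) = false by lia.
    by rewrite ak eqxx /=; field.
  case: (eqVneq (j : nat) b) => [->|jb].
    by rewrite bn eqxx !orbT /=; field.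
  have -> : (j.+1 == k) = false by lia.
  have -> : (j.+1 == n) = false by lia.
  by rewrite /=; field.
rewrite tpermD 1?eq_sym //.
have iNaN : i != a :> nat by [].
have iNbN : i != b :> nat by [].
rewrite modn_small; last lia.
have -> : (i.+1 < n)%N by lia.
have -> : (i.+1 == k) = false by lia.
have -> : (i.+1 == n) = false by lia.
rewrite /= orbF !eqSS.
case: (eqVneq (j : nat) i.+1) => [->|jS].
  have -> : (i.+1 == i :> nat) = false by lia.
  by rewrite /=; field.
by case: (eqVneq (j : nat) i) => _; rewrite /=; field.
Qed.

(** On [S] absolute differences dominate signed ones, and the terms outside [S]
    are dropped; for distributions these contribute as much again, whence the
    factor 1/2 below the optimal bound. *)
Lemma tv_dist_ge (R : realType) n (mu nu : 'rV[R]_n) (S : {set 'I_n}) :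
  2^-1 * (\sum_(x in S) mu 0 x - \sum_(x in S) nu 0 x) <= tv_dist mu nu.
Proof.
rewrite ler_wpM2l ?invr_ge0 // -sumrB (bigID (mem S) xpredT) /=.
by apply: ler_wpDr; [exact: sumr_ge0 | apply: ler_sum => x _; exact: ler_norm].
Qed.

Lemma powR_three_halves_le (R : realType) (n q : nat) :
  (n <= q ^ 4)%N -> n%:R `^ (3 / 2) <= q%:R ^+ 6 :> R.
Proof.
move=> le_nq; have q_ge0 : 0 <= q%:R :> R by [].
have -> : q%:R ^+ 6 = (q%:R ^+ 4) `^ (3 / 2) :> R.
  rewrite -[q%:R ^+ 4]powR_mulrn // -powRrM -powR_mulrn //.
  by congr (_ `^ _); field.
by apply: ge0_ler_powR; rewrite ?nnegrE -?natrX ?ler_nat //; lra.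
Qed.

(** The natural number p replaces n^(1/4) up to constants: the windows of the two
    counters get widths of order p^3 and p, and time is cut at order p^6. *)
Lemma fourth_root_scale n : (16 <= n)%N ->
  exists p, [/\ (0 < p)%N, ((2 * p) ^ 4 <= n)%N & (n <= (4 * p) ^ 4)%N].
Proof.
move=> n16; pose fits p := ((2 * p) ^ 4 <= n)%N.
have fits1 : exists p, fits p by exists 1%N; rewrite /fits.
have bound p : fits p -> (p <= n)%N.
  by apply: leq_trans; rewrite expnMn; case: p => // p; rewrite !expnS; nia.
case: (ex_maxnP fits1 bound) => p fits_p max_p.
have p_gt0 : (0 < p)%N by apply: max_p.
exists p; split=> //; apply: ltnW.
apply: leq_trans (_ : (2 * p.+1) ^ 4 <= _)%N; last by rewrite leq_exp2r //; lia.
by rewrite ltnNge; apply/negP => /max_p; rewrite ltnn.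
Qed.

(** The windows A = p^3 and B = p give a tube of at most 4 p^4 <= n / 4 vertices.
    From a start with few hub visits the walk leaves it with probability at most
    1/8 through the rotation count, and at most
    (1 + 3/2 p^2 / 16) / (9 p^2) <= 1/8 through the jump count. *)
Lemma mix_dist_gt (R : realType) n k p t :
    (2 <= k <= n - 2)%N -> (0 < p)%N -> ((2 * p) ^ 4 <= n)%N ->
    (2 * t <= p ^ 6)%N ->
  8^-1 < mix_dist (cycle_edge_chain R n k) uniform_dist t.
Proof.
move=> kn p_gt0 le_pn le_tp.
have lt_a : (k.-1 < n)%N by lia.
have lt_b : (n.-1 < n)%N by lia.
pose a := Ordinal lt_a; pose b := Ordinal lt_b.
have lt_ab : (a < b)%N by rewrite /=; lia.
have pR : 1 <= p%:R :> R by rewrite (ler_nat R 1).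
have p2R : 1 <= p%:R ^+ 2 :> R by rewrite exprn_ege1.
have nR : 16 * p%:R ^+ 4 <= n%:R :> R.
  by move: le_pn; rewrite -(ler_nat R) natrX natrM exprMn; lra.
have n_gt0 : 0 < n%:R :> R by rewrite ltr0n; lia.
have tR : 2 * t%:R <= p%:R ^+ 6 :> R.
  by move: le_tp; rewrite -(ler_nat R) natrX natrM.
have [x0 visits] : exists x0, n%:R * hub_visits a b t x0 0 <= (2 * t)%:R :> R.
  apply/existsP; apply: contraT; rewrite negb_exists => /forallP few.
  have : \sum_(x < n) (2 * t)%:R < \sum_(x < n) n%:R * hub_visits a b t x 0 :> R.
    apply: ltr_sum => [|x _]; last by rewrite ltNge few.
    by apply/hasP; exists a; rewrite // mem_index_enum.
  rewrite -mulr_sumr sum_hub_visits; last by rewrite neq_ltn lt_ab.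
  by rewrite sumr_const card_ord mulr_natl ltxx.
have := hub_walk_tube a b lt_ab erefl x0 t (p ^ 3) p.
rewrite expn_gt0 p_gt0 => /(_ R isT isT) tube_mass.
set S := tube a x0 t (p ^ 3) p in tube_mass.
have S_small : \sum_(y in S) (uniform_dist : 'rV[R]_n) 0 y <= 4^-1.
  under eq_bigr do rewrite mxE.
  rewrite sumr_const -[_ *+ #|_|]mulr_natl ler_pdivrMr //.
  have : (#|S|%:R : R) <= (4 * (p ^ 3 * p))%:R by rewrite ler_nat card_tube.
  by rewrite -expnSr natrM natrX; lra.
have S_likely : 3 / 4 <= \sum_(y in S) (hub_walk a b ^+ t) x0 y :> R.
  apply: le_trans tube_mass; set V := hub_visits _ _ _ _ _ in visits *.
  have rotations : t%:R / (4 * (p ^ 3)%:R ^+ 2) <= 8^-1 :> R.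
    rewrite natrX -exprM ler_pdivrMr; first lra.
    by rewrite mulr_gt0 // exprn_gt0 //; lra.
  have V_le : V <= p%:R ^+ 2 / 16.
    have : n%:R * V <= n%:R * (p%:R ^+ 2 / 16).
      apply: le_trans visits _; rewrite natrM; apply: le_trans tR _.
      have := ler_wpM2r (_ : 0 <= p%:R ^+ 2 / 16) nR.
      by move=> /(_ ltac:(lra)); rewrite -[p%:R ^+ 6]/(_ ^+ (4 + 2)) exprD; lra.
    by rewrite ler_pM2l.
  have jumps : (1 + 3 / 2 * V) / (9 * p%:R ^+ 2) <= 1 / 8.
    by rewrite ler_pdivrMr; lra.
  by lra.
have tv_gt : 8^-1 < tv_dist (law (cycle_edge_chain R n k) x0 t) uniform_dist.
  apply: lt_le_trans (tv_dist_ge _ _ _ _ S).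
  rewrite (cycle_edge_chainE _ _ _ a b kn) //= ?prednK //; [|lia|lia].
  under eq_bigr do rewrite /law -rowE mxE.
  by lra.
apply: lt_le_trans tv_gt _.
exact: (le_bigmax _ (fun x => tv_dist (law _ x t) uniform_dist)).
Qed.

Theorem theorem3 (R : realType) :
  exists gamma eps : R,
    [/\ 0 < gamma, 0 < eps &
      exists N : nat, forall n : nat, (N <= n)%N ->
        forall k : nat, (2 <= k <= n - 2)%N ->
          ((gamma * n%:R `^ (3 / 2))%:E
             <= mixing_time (cycle_edge_chain R n k) uniform_dist eps)%E].
Proof.
(* With n <= (4 p)^4, time gamma n^(3/2) is at most p^6 / 2. *)
exists (2 * 4 ^+ 6)^-1, 8^-1; split; rewrite ?invr_gt0 ?mulr_gt0 ?exprn_gt0 //.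
exists 16%N => n n16 k kn.
have [p [p_gt0 le_pn le_np]] := fourth_root_scale n n16.
apply: le_ereal_inf_tmp => _ [t /= mixed <-]; rewrite lee_fin leNgt.
apply/negP => lt_t; move: mixed; rewrite leNgt => /negP; apply.
apply: (mix_dist_gt _ _ _ p _ kn p_gt0 le_pn).
have := powR_three_halves_le R _ _ le_np.
rewrite -(ler_nat R) natrX [(4 * p)%N%:R]natrM [(2 * t)%N%:R]natrM exprMn.
by lra.
Qed.
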